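(* Let $q\ge 2$, let $A$ be an alphabet with $q$ letters, and let $R_m$ denote the number of rich words of length $m$ over $A$. Let $c>1$ be a constant such that for every rich word over $A$ of length $n\ge 2$ the number of palindromes in its UPS-factorization is at most $c\frac{n}{\ln n}$, and put $\kappa_n=\lceil c\frac{n}{\ln n}\rceil$. Then for every $n\ge 2$, $$R_n\le \sum_{p=1}^{\kappa_n}\ \sum_{\substack{n_1+n_2+\dots+n_p=n\\ n_1,\dots,n_p\ge 1}} R_{\lceil n_1/2\rceil}R_{\lceil n_2/2\rceil}\cdots R_{\lceil n_p/2\rceil}.$$
   Context: A finite word $u=u_1\cdots u_n$ is a palindrome if $u_1\cdots u_n=u_n\cdots u_1$; the empty word is a palindrome. A word of length $n$ is rich if it has exactly $n+1$ distinct palindromic factors (including the empty word). For a rich word $w$, its UPS-factorization is the factorization $w=w_pw_{p-1}\cdots w_1$ into non-empty palindromes such that, for each $i$, $w_i$ is the longest palindromic suffix of $w_pw_{p-1}\cdots w_i$; it exists for every rich word. A constant $c>1$ with the stated property exists (depending on $q$). *)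

(* Defs.v *)
From mathcomp Require Import all_boot all_order all_algebra.
From mathcomp Require Import reals exp.

Set Implicit Arguments.
Unset Strict Implicit.
Unset Printing Implicit Defensive.

Section Words.
Variable A : eqType.
Implicit Types (u v w : seq A) (s : seq (seq A)).

Definition palindrome u : bool := rev u == u.

(* With repetitions; [mem_factors] identifies it with MathComp's [infix]. *)
Definition factors w : seq (seq A) :=
  [seq take l (drop i w) | i <- iota 0 (size w).+1, l <- iota 0 (size w).+1].

Lemma mem_factors u w : (u \in factors w) = infix u w.
Proof.
apply/allpairsP/idP => [[[i l] /= [_ _ ->]]|/infixP[p [t ->]]].
  apply/infixP; exists (take i w), (drop l (drop i w)).
  by rewrite !cat_take_drop.
exists (size p, size u); split.
- by rewrite mem_iota !size_cat /= add0n ltnS leq_addr.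
- by rewrite mem_iota !size_cat /= add0n ltnS addnCA leq_addr.
- by rewrite /= drop_size_cat // take_size_cat.
Qed.

Definition rich w : bool :=
  size (undup [seq u <- factors w | palindrome u]) == (size w).+1.

Definition longest_pal_suffix u v : Prop :=
  [/\ suffix u v, palindrome u &
      forall t, suffix t v -> palindrome t -> size t <= size u].

(* The factorization w = w_p ... w_1 is the list s = [:: w_p; ...; w_1], so
   that w_p ... w_i is the concatenation of a non-empty prefix of s, and w_i
   the last entry of that prefix. *)
Definition UPS_factorization w s : Prop :=
  [/\ flatten s = w,
      forall u, u \in s -> u != [::] /\ palindrome u &
      forall j, j < size s ->
        longest_pal_suffix (nth [::] s j) (flatten (take j.+1 s))].

End Words.

Definition num_rich (A : finType) (m : nat) : nat :=
  #|[pred w : m.-tuple A | rich w]|.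

(* [absz] only casts from int to nat here: for 1 < c and 2 <= n the ceiling is
   positive. *)
Definition kappa (R : realType) (c : R) (n : nat) : nat :=
  absz (Num.ceil (c * (n%:R / ln n%:R)))%R.

(* A composition of n into p positive parts; parts are at most n, so bounding
   them by 'I_n.+1 loses nothing. *)
Definition composition (n p : nat) (f : {ffun 'I_p -> 'I_n.+1}) : bool :=
  [forall i, 0 < f i] && (\sum_(i < p) (f i : nat) == n).

(* Main.v *)
(** Appending one letter to a word creates at most one new palindromic factor,
    the longest palindromic suffix, because every shorter palindromic suffix is
    mirrored to a prefix of it.  By reversal the same holds on the left, so every
    factor of a rich word is rich.  In particular the parts of the
    UPS-factorization are rich palindromes, and a palindrome of length [m] is
    determined by its prefix of length [uphalf m], itself a rich word. *)
Require Import Defs.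
From mathcomp Require Import all_boot all_order all_algebra.
From mathcomp Require Import reals exp.

Section RichWords.
Variable A : eqType.
Implicit Types (u v w t : seq A) (s : seq (seq A)).

Definition pal_factors w : seq (seq A) :=
  undup [seq u <- factors w | palindrome u].

Lemma mem_pal_factors u w : (u \in pal_factors w) = palindrome u && infix u w.
Proof. by rewrite mem_undup mem_filter mem_factors. Qed.

Lemma richE w : rich w = (size (pal_factors w) == (size w).+1).
Proof. by []. Qed.

Lemma longest_pal_suffix_ex w : exists u, longest_pal_suffix u w.
Proof.
have Pex : exists i, palindrome (drop i w) by exists (size w); rewrite drop_size.
case: (ex_minnP Pex) => i pal_i min_i.
exists (drop i w); split => // [|t /suffixP[p def_w] pal_t].
  by apply/suffixP; exists (take i w); rewrite cat_take_drop.
have def_t : drop (size p) w = t by rewrite def_w drop_size_cat.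
by rewrite -def_t !size_drop leq_sub2l // min_i // def_t.
Qed.

Lemma longest_pal_suffix_neq0 u w :
  w != [::] -> longest_pal_suffix u w -> u != [::].
Proof.
case/lastP: w => // w x _ [_ _ /(_ [:: x])]; rewrite -cats1 suffix_suffix.
by case: u => // /(_ isT (eqxx _)).
Qed.

(** Cut off the longest palindromic suffix and factor the prefix that remains. That suffix is
    non-empty, as the last letter alone is a palindrome, so the length drops. *)
Lemma UPS_factorization_ex w : exists s, UPS_factorization w s.
Proof.
have [k] := ubnP (size w); elim: k w => // k IHk w lt_w_k.
have [->|w_neq0] := eqVneq w [::]; first by exists [::].
have [u lps_u] := longest_pal_suffix_ex w.
have u_neq0 := longest_pal_suffix_neq0 _ _ w_neq0 lps_u.
have [/suffixP[p def_w] pal_u _] := lps_u.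
have [|s [flat_s pal_s lps_s]] := IHk p.
  rewrite ltnS in lt_w_k; apply: leq_trans lt_w_k.
  by rewrite def_w size_cat -addn1 leq_add2l lt0n size_eq0.
exists (rcons s u); split.
- by rewrite -cats1 flatten_cat flat_s /= cats0 def_w.
- by move=> v; rewrite mem_rcons inE => /predU1P[->|/pal_s].
- move=> j; rewrite size_rcons ltnS leq_eqVlt => /predU1P[->|lt_j].
    rewrite nth_rcons ltnn eqxx take_oversize ?size_rcons //.
    by rewrite -cats1 flatten_cat flat_s /= cats0 -def_w.
  by rewrite nth_rcons lt_j -cats1 takel_cat //; apply: lps_s.
Qed.

Lemma palindrome_rev u : palindrome u -> rev u = u.
Proof. by move/eqP. Qed.

Lemma infix_rcons_suffix u w x :
  infix u (rcons w x) -> suffix u (rcons w x) \/ infix u w.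
Proof.
case/infixP=> p [t]; case/lastP: t => [|t y].
  by rewrite cats0 => ->; left; apply: suffix_suffix.
rewrite -!rcons_cat => /rcons_inj[-> _]; right.
by apply/infixP; exists p, t.
Qed.

Lemma suffix_suffix_le u v w :
  suffix v w -> suffix u w -> size v <= size u -> suffix v u.
Proof.
rewrite suffixE => /[swap] /suffixP[p ->] /eqP def_v le_vu.
rewrite suffixE -{2}def_v size_cat drop_cat -addnBA //.
by rewrite ltnNge leq_addr /= addKn.
Qed.

Lemma size_pal_factors_rcons w x :
  size (pal_factors (rcons w x)) <= (size (pal_factors w)).+1.
Proof.
have [u [/suffixP[p def_wx] pal_u max_u]] := longest_pal_suffix_ex (rcons w x).
suff sub : {subset pal_factors (rcons w x) <= u :: pal_factors w}.
  by apply: (uniq_leq_size _ sub); apply: undup_uniq.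
move=> v; rewrite mem_pal_factors inE mem_pal_factors.
case/andP=> pal_v /infix_rcons_suffix[suf_v|->]; last by rewrite pal_v orbT.
rewrite pal_v /=; have le_vu := max_u v suf_v pal_v.
have {suf_v} /suffixP[r def_u] : suffix v u.
  apply: suffix_suffix_le suf_v _ le_vu.
  by apply/suffixP; exists p.
case: r def_u => [->|y r def_u]; first by rewrite eqxx.
apply/orP; right.
(* the mirror image inside [u] of its proper suffix [v] misses the last letter *)
have : rcons w x = rcons (p ++ v ++ rev r) y.
  rewrite def_wx -(palindrome_rev _ pal_u) def_u rev_cat (palindrome_rev _ pal_v).
  by rewrite rev_cons -!rcons_cat.
by case/rcons_inj=> -> _; apply/infixP; exists p, (rev r).
Qed.

(** Reversal fixes every palindrome, so a word and its reverse have the same palindromic factors. *)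
Lemma size_pal_factors_rev w :
  size (pal_factors (rev w)) = size (pal_factors w).
Proof.
apply/perm_size/uniq_perm; rewrite ?undup_uniq // => u.
rewrite !mem_pal_factors; case pal_u: (palindrome u) => //=.
by rewrite -{1}(palindrome_rev _ pal_u) infix_rev.
Qed.

Lemma size_pal_factors_cat w t :
  size (pal_factors (w ++ t)) <= size (pal_factors w) + size t.
Proof.
elim/last_ind: t => [|t x IHt]; first by rewrite cats0 addn0.
rewrite -rcons_cat size_rcons addnS.
exact: leq_trans (size_pal_factors_rcons _ _) _.
Qed.

Lemma size_pal_factors w : size (pal_factors w) <= (size w).+1.
(* The empty word has one palindromic factor, itself; hence the [.+1]. *)
Proof. by have := size_pal_factors_cat [::] w. Qed.

(** Removing [t], then [p], from [p ++ u ++ t] loses at most one palindromic factor per letter, so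
    [u] still reaches the maximum [(size u).+1]. *)
Lemma rich_infix u w : infix u w -> rich w -> rich u.
Proof.
case/infixP=> p [t ->]; rewrite !richE eqn_leq => /andP[_].
rewrite eqn_leq size_pal_factors /= catA !size_cat -addSn => le_w.
have := leq_trans le_w (size_pal_factors_cat _ _); rewrite leq_add2r.
(* The prefix [p] is removed as the suffix [rev p] of the reversed word. *)
rewrite -size_pal_factors_rev rev_cat => le_pu.
have := leq_trans le_pu (size_pal_factors_cat _ _).
by rewrite size_pal_factors_rev size_rev -addnS [_ + size p]addnC leq_add2l.
Qed.

(** Mirrors the first half [h] of a palindrome of length [m]; for odd [m] the middle letter ends [h]
    and must not be repeated. *)
Definition unfold_pal m (h : seq A) : seq A := h ++ drop (odd m) (rev h).

Lemma uphalf_le m : uphalf m <= m.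
Proof. by rewrite leq_uphalf_double -addnn leq_addr. Qed.

Lemma palindrome_unfold u : palindrome u ->
  u = unfold_pal (size u) (take (uphalf (size u)) u).
Proof.
move=> pal_u; rewrite /unfold_pal -[LHS](cat_take_drop (uphalf (size u))).
(* Both second halves are the reverse of the prefix of [u] of length [(size u)./2]. *)
congr cat; rewrite -{2}(palindrome_rev _ pal_u) !drop_rev.
rewrite size_takel ?uphalf_le // take_takel ?leq_subr //; congr (rev (take _ _)).
rewrite uphalf_half addKn -{1}(odd_double_half (size u)) subnDl -addnn.
by rewrite addnK.
Qed.

End RichWords.

Section Counting.
Variable A : finType.

Definition rich_words m : seq (seq A) :=
  [seq val w | w : m.-tuple A in [pred w | rich (val w)]].

Lemma size_rich_words m : size (rich_words m) = num_rich A m.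
Proof. by rewrite size_map -cardE. Qed.

Lemma mem_rich_words m (w : seq A) :
  (w \in rich_words m) = (size w == m) && rich w.
Proof.
apply/imageP/andP => [[v rich_v ->]|[sz_w rich_w]].
  by rewrite size_tuple eqxx.
by exists (Tuple sz_w).
Qed.

(** Repetitions are harmless for an upper bound, and keeping them makes the size exactly a product
    of counts. *)
Fixpoint pal_products (ns : seq nat) : seq (seq A) :=
  if ns is m :: ns' then
    [seq unfold_pal A m h ++ t | h <- rich_words (uphalf m), t <- pal_products ns']
  else [:: [::]].

Lemma size_pal_products ns :
  size (pal_products ns) = \prod_(m <- ns) num_rich A (uphalf m).
Proof.
elim: ns => [|m ns IHns]; first by rewrite big_nil.
by rewrite big_cons size_allpairs size_rich_words IHns.
Qed.

(** The first half of the head and the concatenation of the tail are factors of the rich word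
    [flatten s], so both are rich and the induction proceeds. *)
Lemma mem_pal_products (s : seq (seq A)) :
  (forall u, u \in s -> palindrome u) -> rich (flatten s) ->
  flatten s \in pal_products (shape s).
Proof.
elim: s => //= u s IHs pal_s rich_us.
rewrite {1}(palindrome_unfold _ u) ?pal_s ?mem_head //.
apply: allpairs_f; last first.
  apply: IHs => [v s_v|]; first by apply: pal_s; rewrite inE s_v orbT.
  exact: rich_infix (suffix_infix _ _) rich_us.
rewrite mem_rich_words size_takel ?uphalf_le // eqxx /=.
apply: rich_infix rich_us; apply/prefixW.
exact: prefix_trans (prefix_take _ _) (prefix_prefix _ _).
Qed.

End Counting.

Lemma composition_of_shape (n : nat) (ns : seq nat) :
  sumn ns = n -> all (leq 1) ns ->
  exists2 f : {ffun 'I_(size ns) -> 'I_n.+1},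
    composition f & [seq (f i : nat) | i <- enum 'I_(size ns)] = ns.
Proof.
move=> sum_ns pos_ns; pose f := [ffun i : 'I_(size ns) => inord (nth 0 ns i) : 'I_n.+1].
(* [inord] falls back to its default only beyond [n], which no part exceeds because the parts sum to
   [n]. *)
have fE i : f i = nth 0 ns i :> nat.
  rewrite ffunE inordK // ltnS -sum_ns sumnE (big_nth 0) big_mkord.
  by rewrite (bigD1 i) //= leq_addr.
have codom_f : [seq (f i : nat) | i <- enum 'I_(size ns)] = ns.
  rewrite (eq_map fE) -[RHS](mkseq_nth 0) /mkseq -val_enum_ord -map_comp.
  exact: eq_map.
exists f => //; apply/andP; split.
  by apply/forallP=> i; rewrite fE; apply: (allP pos_ns); rewrite mem_nth.
by have := congr1 sumn codom_f; rewrite sumnE big_map big_enum sum_ns /= => ->.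
Qed.

Import Order.TTheory GRing.Theory Num.Theory.

(** A ceiling bounded below by a natural number is non-negative, so [absz] keeps its value. *)
Lemma nat_le_absz_ceil (R : realType) (x : R) (k : nat) :
  (k%:R <= x)%R -> k <= `|Num.ceil x|%N.
Proof.
move=> le_kx; have : (k%:Z <= Num.ceil x)%R.
  by rewrite -(ler_int R) -pmulrn (le_trans le_kx) ?ceil_ge.
by case: (Num.ceil x).
Qed.

Theorem theorem2 (R : realType) (q : nat) (hq : 2 <= q)
    (A : finType) (hA : #|A| = q)
    (c : R) (hc : (1 < c)%R)
    (hUPS : forall (n : nat) (w : seq A) (s : seq (seq A)),
       2 <= n -> size w = n -> rich w -> UPS_factorization w s ->
       ((size s)%:R <= c * (n%:R / ln n%:R))%R)
    (n : nat) (hn : 2 <= n) :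
  num_rich A n <=
    \sum_(1 <= p < (kappa c n).+1)
      \sum_(f : {ffun 'I_p -> 'I_n.+1} | composition f)
        \prod_(i < p) num_rich A (uphalf (f i)).
Proof.
pose prods p := [seq pal_products A [seq (f i : nat) | i <- enum 'I_p]
                | f : {ffun 'I_p -> 'I_n.+1} in [pred f | composition f]].
pose all_prods := flatten [seq flatten (prods p) | p <- index_iota 1 (kappa c n).+1].
have -> : \sum_(1 <= p < (kappa c n).+1)
    \sum_(f : {ffun 'I_p -> 'I_n.+1} | composition f)
      \prod_(i < p) num_rich A (uphalf (f i)) = size all_prods.
  rewrite size_flatten sumnE big_map big_map; apply: eq_bigr => p _.
  rewrite size_flatten sumnE big_map big_map big_enum_cond /=.
  apply: eq_big => [f|f _]; first by rewrite ?andbT.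
  by rewrite size_pal_products big_map big_enum.
(* The rich words are listed without repetition, so it suffices that each occurs in [all_prods]. *)
rewrite -size_rich_words; apply: uniq_leq_size => [|w].
  by rewrite map_inj_uniq ?enum_uniq //; apply: val_inj.
rewrite mem_rich_words => /andP[/eqP sz_w rich_w].
have [s ups_s] := UPS_factorization_ex A w.
have [flat_s pal_s _] := ups_s.
have le_s_kappa : size s <= kappa c n.
  by apply: nat_le_absz_ceil; apply: hUPS hn sz_w rich_w ups_s.
(* The outer sum starts at [p = 1]; a word of length at least 2 has at least one part. *)
have s_gt0 : 0 < size s.
  by case: s flat_s {ups_s pal_s le_s_kappa} => // w0; rewrite -sz_w -w0 in hn.
have sum_s : sumn (shape s) = n by rewrite -size_flatten flat_s.
have pos_s : all (leq 1) (shape s).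
  apply/allP=> _ /mapP[u s_u ->]; have [u_neq0 _] := pal_s u s_u.
  by rewrite lt0n size_eq0.
have [f comp_f def_f] := composition_of_shape _ _ sum_s pos_s.
(* The index is [size (shape s)] rather than [size s], to match the domain of [f]. *)
apply/flatten_mapP; exists (size (shape s)).
  by rewrite mem_index_iota ltnS size_map s_gt0.
apply/flattenP; exists (pal_products A (shape s)).
  by apply/imageP; exists f => //; rewrite def_f.
rewrite -flat_s; apply: mem_pal_products => [u /pal_s[]//|].
by rewrite flat_s.
Qed.
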